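(* Let $f\colon K\to L$ be a simplicial map between finite connected simplicial complexes. Then $\mathrm{cat}(\chi(f))\leq \mathrm{scat}(f)$.
   Context: Simplicial complexes are abstract, finite and (edge-path) connected; subcomplexes of a given complex (e.g. members of covers) are not required to be connected. A simplicial map $f\colon K\to L$ is a map of vertex sets sending simplices to simplices. Simplicial maps $f,g\colon K\to L$ are contiguous, $f\sim_c g$, if $f(\sigma)\cup g(\sigma)$ is a simplex of $L$ for every simplex $\sigma$ of $K$. They are in the same contiguity class, $f\sim g$, if there are simplicial maps $f=f_0\sim_c f_1\sim_c\cdots\sim_c f_m=g$ from $K$ to $L$. The symbol $*$ denotes a map sending every vertex to a single vertex of the codomain; $f\sim *$ means $f\sim c$ for some such constant map $c$. $\mathrm{scat}(f)$ is the least integer $n\ge 0$ such that $K$ is a union of subcomplexes $U_0,\dots,U_n$ with $f|_{U_j}\sim *$ (as maps $U_j\to L$) for all $0\le j\le n$. A finite poset $(P,\le)$ is regarded as a finite $T_0$-space with basis of open sets $U_x=\{y\in P: y\le x\}$, $x\in P$. For a simplicial complex $K$, $\chi(K)$ is the finite $T_0$-space given by the poset of (nonempty) simplices of $K$ ordered by inclusion, and for a simplicial map $f\colon K\to L$, $\chi(f)\colon\chi(K)\to\chi(L)$ is the continuous map $\sigma\mapsto f(\sigma)$. For a continuous map $h\colon X\to Y$, $\mathrm{cat}(h)$ is the classical Lusternik--Schnirelmann category: the least integer $n\ge0$ such that $X$ is covered by open sets $U_0,\dots,U_n$ with each $h|_{U_j}\colon U_j\to Y$ homotopic to a constant map. 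*)

(* Defs.v *)
From HB Require Import structures.
From mathcomp Require Import all_boot all_order all_algebra.

Set Implicit Arguments.
Unset Strict Implicit.
Unset Printing Implicit Defensive.

(* [V] is an ambient finite set of labels: the vertices of [K] are only the
   [v] with [[set v] \in K], so that the subcomplexes of [K] have the same
   type as [K]. *)
Record scomplex (V : finType) := SComplex {
  simplices :> {set {set V}};
  simplex_neq0 : set0 \notin simplices;
  simplex_sub : forall s t : {set V},
    s \in simplices -> t != set0 -> t \subset s -> t \in simplices }.

Definition vertices (V : finType) (K : scomplex V) : {set V} :=
  [set v | [set v] \in K].

Definition edge_connected (V : finType) (K : scomplex V) : Prop :=
  vertices K != set0 /\
  {in vertices K &, forall u v,
    connect [rel x y | [set x; y] \in K] u v}.

(* The values outside of [vertices K] carry no information. *)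
Record smap (V W : finType) (K : scomplex V) (L : scomplex W) := SMap {
  vertex_map :> V -> W;
  smapP : forall s : {set V}, s \in K ->
    [set vertex_map x | x in s] \in L }.

Definition contiguous (V W : finType) (K : scomplex V) (L : scomplex W)
    (f g : V -> W) : Prop :=
  forall s : {set V}, s \in K ->
    [set f x | x in s] :|: [set g x | x in s] \in L.

Definition same_contiguity_class (V W : finType) (K : scomplex V)
    (L : scomplex W) (f g : V -> W) : Prop :=
  exists (m : nat) (F : nat -> smap K L),
    [/\ {in vertices K, F 0 =1 f}, {in vertices K, F m =1 g} &
        forall i, i < m -> contiguous K L (F i) (F i.+1)].

(* The function [f] stands here for its restriction to [U]. *)
Definition scat_cover (V W : finType) (K : scomplex V) (L : scomplex W)
    (f : smap K L) (n : nat) : Prop :=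
  exists U : 'I_n.+1 -> scomplex V,
    (K : {set {set V}}) = (\bigcup_(j < n.+1) U j) /\
    forall j, exists2 w, w \in vertices L &
      same_contiguity_class (U j) L f (fun=> w).

(* Imported only here: the notations of [classical_sets] shadow those of
   [finset] used above. *)
From mathcomp Require Import all_classical all_reals all_analysis.

Import Order.TTheory GRing.Theory Num.Theory.
Import numFieldNormedType.Exports.

Local Open Scope classical_set_scope.
Local Open Scope ring_scope.

(* The least natural number satisfying [P], [+oo] if there is none. *)
Definition least_nat (R : realType) (P : nat -> Prop) : \bar R :=
  ereal_inf [set n%:R%:E | n in [set n | P n]].

Lemma least_natE (R : realType) (P : nat -> Prop) (n : nat) :
  P n -> (forall m, P m -> (n <= m)%N) -> least_nat R P = n%:R%:E.
Proof.
move=> Pn minn; apply/eqP; rewrite eq_le; apply/andP; split.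
  by apply: ereal_inf_lbound; exists n.
by apply: le_ereal_inf_tmp => _ [m /minn nm <-]; rewrite lee_fin ler_nat.
Qed.

Definition scat (R : realType) (V W : finType) (K : scomplex V)
    (L : scomplex W) (f : smap K L) : \bar R :=
  least_nat R (scat_cover f).

(* A homotopy from [f] to [g] restricted to the subspace [U]; the values of [H]
   outside of [U `*` [0, 1]] are irrelevant. *)
Definition homotopic_on (R : realType) (X Y : topologicalType) (U : set X)
    (f g : X -> Y) : Prop :=
  exists H : X * R -> Y,
    [/\ {within U `*` `[0, 1]%classic, continuous H},
        forall x, U x -> H (x, 0) = f x &
        forall x, U x -> H (x, 1) = g x].

Definition LScat_cover (R : realType) (X Y : topologicalType)
    (h : continuousType X Y) (n : nat) : Prop :=
  exists U : 'I_n.+1 -> set X,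
    [/\ forall j, open (U j),
        \bigcup_j U j = setT &
        forall j, exists y : Y, homotopic_on R (U j) h (cst y)].

Definition LScat (R : realType) (X Y : topologicalType)
    (h : continuousType X Y) : \bar R :=
  least_nat R (LScat_cover R h).

Definition poset_space (d : Order.disp_t) (P : finPOrderType d) : Type := P.

Section PosetSpace.
Context {d : Order.disp_t} (P : finPOrderType d).

Definition down_set (x : P) : set P := [set y | (y <= x)%O].

HB.instance Definition _ := Choice.on (poset_space P).

Let down_cover : \bigcup_(A in range down_set) A = [set: poset_space P].
Proof.
apply/seteqP; split=> // x _.
by exists (down_set x); [exists x | exact: lexx].
Qed.

Let down_join (A B : set P) (t : poset_space P) :
  range down_set A -> range down_set B -> A t -> B t ->
  exists C, [/\ range down_set C, C t & C `<=` A `&` B].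
Proof.
move=> [a _ <-] [b _ <-] ta tb; exists (down_set t); split.
- by exists t.
- exact: lexx.
- by move=> y yt; split; apply: le_trans yt _.
Qed.

HB.instance Definition _ :=
  isBaseTopological.Build (poset_space P) down_cover down_join.

Lemma poset_nbhsP (x : poset_space P) (A : set (poset_space P)) :
  nbhs x A <-> down_set x `<=` A.
Proof.
rewrite nbhsE /=; split=> [[B [[D' sD' <-] [C D'C Cx] sBA]] y yx|sA].
  apply: sBA; exists C => //.
  by have [c _ cE] := sD' _ D'C; move: Cx; rewrite -cE; exact: le_trans yx.
exists (down_set x) => //; split; last exact: lexx.
exists [set down_set x] => [_ ->|]; first by exists x.
exact: bigcup_set1.
Qed.

End PosetSpace.

Lemma homo_poset_continuous (d d' : Order.disp_t) (P : finPOrderType d)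
    (Q : finPOrderType d') (h : P -> Q) :
  {homo h : x y / (x <= y)%O} ->
  continuous (h : poset_space P -> poset_space Q).
Proof.
move=> hh x A /poset_nbhsP sA; apply/poset_nbhsP => y yx.
by apply: sA; exact: hh.
Qed.

Section FacePoset.
Context {V : finType} (K : scomplex V).

Definition simplex : Type := {s : {set V} | s \in K}.

HB.instance Definition _ := Finite.on simplex.

Definition face (s t : simplex) : bool := sval s \subset sval t.

Let face_refl : reflexive face. Proof. by move=> s; exact: subxx. Qed.

Let face_anti : antisymmetric face.
Proof. by move=> s t st; apply/val_inj/eqP; rewrite finset.eqEsubset. Qed.

Let face_trans : transitive face.
Proof. by move=> t s u; exact: fintype.subset_trans. Qed.

HB.instance Definition _ := Order.Le_isPOrder.Build Order.SetSubsetOrder.subset_display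
  simplex face_refl face_anti face_trans.

End FacePoset.

Definition chi (V : finType) (K : scomplex V) : topologicalType :=
  poset_space (simplex K).

Section ChiMap.
Context {V W : finType} {K : scomplex V} {L : scomplex W} (f : smap K L).

Definition chi_fun (s : simplex K) : simplex L :=
  exist _ [set f x | x in sval s]%SET (smapP f (svalP s)).

Lemma chi_fun_continuous : continuous (chi_fun : chi K -> chi L).
Proof. by apply: homo_poset_continuous => s t; exact: imsetS. Qed.

Definition chi_map : continuousType (chi K) (chi L) :=
  mkcts chi_fun_continuous.

End ChiMap.

(* Main.v *)
Require Import Defs.
From mathcomp Require Import all_boot all_order all_algebra.
From mathcomp Require Import all_classical all_reals all_analysis.
From mathcomp Require Import lra.

Import Order.TTheory GRing.Theory Num.Theory.
Import numFieldNormedType.Exports.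

Local Open Scope classical_set_scope.
Local Open Scope ring_scope.

Lemma simplex_nonempty {V : finType} {K : scomplex V} {s : {set V}} :
  s \in K -> s != finset.set0.
Proof. by move=> sK; apply: contraNneq (simplex_neq0 K) => <-. Qed.

Lemma mem_vertices {V : finType} {K : scomplex V} {s : {set V}} {v : V} :
  s \in K -> v \in s -> v \in vertices K.
Proof.
move=> sK vs; rewrite finset.inE; apply: (simplex_sub sK).
  by apply/finset.set0Pn; exists v; rewrite finset.inE.
by rewrite finset.sub1set.
Qed.

Lemma imset_cst {V W : finType} {s : {set V}} (w : W) :
  s != finset.set0 -> [set w | _ in s]%SET = [set w]%SET.
Proof.
case/finset.set0Pn=> v vs; apply/finset.setP => y; rewrite finset.inE.
by apply/imsetP/eqP => [[]//|->]; exists v.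
Qed.

Lemma const_smap_subproof {V W : finType} (K : scomplex V) {L : scomplex W}
    {w : W} (wL : w \in vertices L) (s : {set V}) :
  s \in K -> [set w | _ in s]%SET \in L.
Proof.
by move=> /simplex_nonempty s0; rewrite imset_cst//; rewrite finset.inE in wL.
Qed.

Definition const_smap {V W : finType} (K : scomplex V) {L : scomplex W}
    {w : W} (wL : w \in vertices L) : smap K L :=
  SMap (const_smap_subproof K wL).

Section ContiguityHomotopy.
Context {R : realType} {V W : finType} {K U : scomplex V} {L : scomplex W}.
Context {f g : smap K L} {m : nat} {F : nat -> smap U L}.
Context (F0 : {in vertices U, F 0%N =1 f}) (Fm : {in vertices U, F m =1 g}).
Context (FS : forall i, (i < m)%N -> contiguous U L (F i) (F i.+1)).

Let active (t : R) (i : nat) : bool := `|m%:R * t - i%:R| <= 2^-1.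

(* The map [F i] contributes for [t] within [1 / 2m] of [i / m], so that two
   consecutive maps overlap exactly at the midpoints.  The contributing set is
   upper semicontinuous in [t], which is continuity for the topology whose
   open sets are the down-sets. *)
Definition blend (s : {set V}) (t : R) : {set W} :=
  (\bigcup_(i < m.+1 | active t i) [set F i x | x in s])%SET.

(** Only the integers [k] and [k.+1] around [m * t] can be active, so the blend is a nonempty subset
    of the simplex that contiguity of [F k] and [F k.+1] provides. *)
Lemma blend_simplex (s : {set V}) (t : R) :
  s \in U -> 0 <= t <= 1 -> blend s t \in L.
Proof.
move=> sU /andP[t0 t1].
have m0 : 0 <= m%:R :> R by [].
have mt0 : 0 <= m%:R * t by nra.
have mtm : m%:R * t <= m%:R by nra.
have /andP[kt tk] := truncn_itv mt0.
set k := Num.truncn _ in kt tk.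
have km : (k <= m)%N by rewrite -(ler_nat R); exact: le_trans kt mtm.
have activeE i : active t i -> i = k \/ i = k.+1.
  rewrite /active ler_norml => /andP[h1 h2].
  have : (k < i.+1)%N by rewrite -(ltr_nat R) -natr1; lra.
  have : (i < k.+2)%N.
    by rewrite -(ltr_nat R) -natr1; rewrite -natr1 in tk *; lra.
  by rewrite !ltnS leq_eqVlt ltnS => /orP[/eqP|ik ki];
    [right | left; apply/eqP; rewrite eqn_leq ik].
(* The integer nearest to [m * t] is active. When it is [k.+1], the bound [m * t <= m] keeps it in
   range. *)
have [i ai] : exists i : 'I_m.+1, active t i.
  have [kt2|kt2] := leP (m%:R * t - k%:R) 2^-1.
    exists (Ordinal (km : (k < m.+1)%N)); rewrite /active /= ger0_norm//.
    by rewrite subr_ge0.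
  have ltkm : (k < m)%N by rewrite -(ltr_nat R); lra.
  exists (Ordinal (ltkm : (k.+1 < m.+1)%N)); rewrite /active /= ler_norml.
  by rewrite -natr1 in tk *; lra.
have blend_neq0 : blend s t != finset.set0.
  have /finset.set0Pn[v vs] := simplex_nonempty sU.
  apply/finset.set0Pn; exists (F i v).
  by apply/bigcupP; exists i => //; exact: imset_f.
(* If [k = m], there is no contiguity step to use, but [k.+1] is out of range and [F m] alone
   contributes. *)
move: km; rewrite leq_eqVlt => /orP[/eqP km|ltkm].
  apply: (simplex_sub (smapP (F m) sU)) => //; apply/bigcupsP => j /activeE.
  rewrite km; case=> [->//|jm].
  by have := ltn_ord j; rewrite jm ltnn.
apply: (simplex_sub (FS _ ltkm _ sU)) => //; apply/bigcupsP => j /activeE[]->.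
  exact: finset.subsetUl.
exact: finset.subsetUr.
Qed.

(** At either end [m * t] is itself an index, and every other index is at distance at least 1 from
    it. *)
Lemma blend0 (s : {set V}) : s \in U -> blend s 0 = [set f x | x in s]%SET.
Proof.
move=> sU; rewrite /blend (bigD1 ord0)/=; last first.
  by rewrite /active mulr0 subr0 normr0 invr_ge0.
rewrite big1 ?finset.setU0 => [|i /andP[ai]].
  by apply: eq_in_imset => x xs; apply: F0; exact: mem_vertices xs.
rewrite -lt0n => i0; move: ai.
rewrite /active mulr0 sub0r normrN normr_nat => ai.
by move: i0; rewrite -(ler_nat R) => i0; exfalso; lra.
Qed.

Lemma blend1 (s : {set V}) : s \in U -> blend s 1 = [set g x | x in s]%SET.
Proof.
move=> sU; rewrite /blend (bigD1 ord_max)/=; last first.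
  by rewrite /active mulr1 subrr normr0 invr_ge0.
rewrite big1 ?finset.setU0 => [|i /andP[ai im]].
  by apply: eq_in_imset => x xs; apply: Fm; exact: mem_vertices xs.
have lim : (i < m)%N by rewrite ltn_neqAle im -ltnS ltn_ord.
move: ai; rewrite /active mulr1 ler_norml => /andP[_ mi].
by move: lim; rewrite -(ler_nat R) -natr1 => lim; exfalso; lra.
Qed.

(** Being active is a closed condition on the time, so an inactive index stays inactive nearby;
    finitely many indices allow a common neighbourhood. *)
Lemma near_active (t : R) :
  \forall u \near t, forall i : 'I_m.+1, active u i -> active t i.
Proof.
apply: (@filter_forall R _ (fun (i : 'I_m.+1) u => active u i -> active t i)
  (nbhs t) _ _) => i.
case: (boolP (active t i)) => [_|]; first by apply: nearW.
rewrite /active -ltNge => lti.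
have ct : (fun u : R => `|m%:R * u - i%:R|) @ t --> `|m%:R * t - i%:R|.
  apply: cvg_norm; apply: cvgB; last exact: cvg_cst.
  by apply: cvgM; [exact: cvg_cst | exact: cvg_id].
apply: (@filterS _ (nbhs t) _ _ _ _ (cvgr_gt _ ct _ lti)) => u.
by rewrite ltNge => /negPf ->.
Qed.

Lemma contiguity_chain_homotopic :
  homotopic_on R [set s : chi K | sval s \in U] (chi_map f) (chi_map g).
Proof.
pose H (p : chi K * R) : chi L :=
  (* The default value is taken only where the blend is not a simplex of [L], hence never over [U]
     and [[0, 1]]. *)
  insubd (chi_fun f p.1) (blend (sval p.1) p.2) : simplex L.
have valH (s : chi K) (t : R) : sval s \in U -> 0 <= t <= 1 ->
    sval (H (s, t)) = blend (sval s) t.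
  by move=> sU t01; apply: insubdK; exact: blend_simplex.
exists H; split=> [|s sU|s sU].
- apply/subspace_continuousP => -[s t] [/= sU]; rewrite in_itv/= => t01.
  move=> A /poset_nbhsP sA.
  (* On this product the blend can only shrink: faces of [s] have smaller images, and no new index
     becomes active. So [H] stays in the least neighbourhood of [H (s, t)]. *)
  exists (down_set (s : simplex K),
    [set u | forall i : 'I_m.+1, active u i -> active t i]).
    by split; [exact/poset_nbhsP | exact: near_active].
  move=> [s' t'] /= [s's tt'] [s'U]; rewrite in_itv/= => t'01.
  apply: sA; change (sval (H (s', t')) \subset sval (H (s, t))).
  rewrite !valH//; apply/bigcupsP => i /tt' ai.
  apply: fintype.subset_trans (finset.bigcup_sup i ai).
  exact: imsetS.
- by apply/val_inj; rewrite [LHS]valH ?lexx ?ler01// blend0.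
- by apply/val_inj; rewrite [LHS]valH ?lexx ?ler01// blend1.
Qed.

End ContiguityHomotopy.

(** Closure under nonempty faces is closure downwards in the face poset. *)
Lemma open_subcomplex (V : finType) (K U : scomplex V) :
  open [set s : chi K | sval s \in U].
Proof.
rewrite openE => s /= sU; apply/poset_nbhsP => t ts.
apply: (simplex_sub sU); last exact: ts.
exact: simplex_nonempty (svalP (t : simplex K)).
Qed.

Lemma scat_cover_LScat_cover (R : realType) {V W : finType}
    {K : scomplex V} {L : scomplex W} {f : smap K L} {n : nat} :
  scat_cover f n -> LScat_cover R (chi_map f) n.
Proof.
case=> U [KU Ucst]; exists (fun j => [set s | sval s \in U j]); split.
- by move=> j; exact: open_subcomplex.
- apply/seteqP; split=> // s _.
  have /finset.setP/(_ (sval s)) := KU.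
  rewrite (svalP (s : simplex K)) => /esym/bigcupP[j _ sj].
  by exists j.
- move=> j; have [w wL [m [F [F0 Fm FS]]]] := Ucst j.
  have w1 : [set w]%SET \in L by move: wL; rewrite finset.inE.
  exists (exist (fun s => s \in L) _ w1 : simplex L).
  (* As simplices are nonempty, the constant simplicial map at [w] sends each of them to the vertex
     [[set w]]. *)
  rewrite (_ : cst _ = chi_map (const_smap K wL)).
    exact: (contiguity_chain_homotopic (g := const_smap K wL) F0 Fm FS).
  apply/funext => s; apply/val_inj; rewrite /= imset_cst//.
  exact: simplex_nonempty (svalP (s : simplex K)).
Qed.

Theorem proposition29 (R : realType) (V W : finType)
    (K : scomplex V) (L : scomplex W) (f : smap K L)
    (hK : edge_connected K) (hL : edge_connected L) :
  (LScat R (chi_map f) <= scat R f)%E.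
Proof.
(* Every [n] admissible for [scat] is admissible for [LScat], and an infimum over a larger set is
   smaller; this includes the value [+oo]. *)
apply: ereal_inf_le_tmp => _ [n fn <-].
by exists n => //; exact: scat_cover_LScat_cover.
Qed.
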